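(* For every positive integer $m$ and any prime $p$ not dividing $m$ we have $$\sum_{0<k<p}\frac{B_k}{(-m)^k}\equiv (-1)^{m-1}D_{m-1}\pmod p,$$ where $B_k$ denotes the $k$th Bell number and $D_n$ denotes the $n$th derangement number.
   Context: The Bell number $B_n$ is the number of partitions of a set of cardinality $n$ (with $B_0=1$). The derangement number $D_n$ is the number of fixed-point-free permutations of a set of cardinality $n$ (with $D_0=1$); equivalently $\frac{D_n}{n!}=\sum_{k=0}^n\frac{(-1)^k}{k!}$ for $n=0,1,2,\ldots$. The congruence is between rational numbers whose denominators are not divisible by $p$ (i.e. in the ring $\mathbb{Z}_p$ of $p$-adic integers modulo $p$; equivalently, $1/(-m)^k$ is interpreted as the inverse of $(-m)^k$ modulo $p$). *)

(* Defs.v *)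
From mathcomp Require Import all_boot all_order all_algebra all_fingroup.

Set Implicit Arguments.
Unset Strict Implicit.
Unset Printing Implicit Defensive.

Import GRing.Theory.
Local Open Scope ring_scope.

(* [partition] requires nonempty blocks, and the empty family partitions the
   empty set, so [bell 0 = 1]. *)
Definition bell (n : nat) : nat :=
  #|[set P : {set {set 'I_n}} | partition P [set: 'I_n]]|.

Definition derangement (n : nat) : nat :=
  #|[set s : 'S_n | [forall i, s i != i]]|.

(* [denq x] is the denominator of [x] in lowest terms, so for [p] prime these
   are the rationals lying in the ring of p-adic integers. *)
Definition p_integral (p : nat) (x : rat) : bool :=
  ~~ (p%:Z %| denq x)%Z.

(* The congruence is only asserted between p-integral rationals; it says that
   [x - y] lies in the ideal generated by [p] in the ring they form. *)
Definition rat_congr (p : nat) (x y : rat) : Prop :=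
  [/\ p_integral p x, p_integral p y
    & exists2 z : rat, p_integral p z & x - y = p%:R * z].

(* Main.v *)
From HB Require Import structures.
Require Import Defs.
From mathcomp Require Import all_boot all_order all_algebra all_fingroup.
From mathcomp Require Import finfield.
From mathcomp Require Import zify ring.

(* Let L be the linear functional on polynomials with L(X^n) = B_n. The Bell
   recurrence says L(X f(X)) = L(f(X+1)), so L(X(X-1)...(X-n+1)) = 1; over F_p
   the case n = p reads L(X^p - X) = 1. Over F_p one also has
   (X+m)^(p-1) = \sum_(k < p) X^k (-m)^(p-1-k), so the sum in the theorem is
   S_m := L((X+m)^(p-1)) - 1. Shifting gives
   L((X+m+1)^(p-1)) = L(X (X+m)^(p-1)) = L((X+m)^p) - m L((X+m)^(p-1)),
   that is S_(m+1) = 1 - m S_m with S_1 = 1, which is the recurrence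
   satisfied by (-1)^(m-1) D_(m-1). *)

Set Implicit Arguments.
Unset Strict Implicit.
Unset Printing Implicit Defensive.

Import GRing.Theory.
Local Open Scope ring_scope.

(** * Counting set partitions and the Bell recurrence *)

Lemma sum_subset_card (T : finType) (V : nmodType) (A : {set T}) (f : nat -> V) :
  \sum_(B : {set T} | B \subset A) f #|B| =
  \sum_(k < #|A|.+1) f k *+ 'C(#|A|, k).
Proof.
rewrite (partition_big (fun B : {set T} => inord #|B| : 'I_(#|A|.+1)) xpredT) //=.
apply: eq_bigr => k _; rewrite -cards_draws -sumr_const.
have cardBk (B : {set T}) :
    (B \subset A) && (inord #|B| == k) = (B \in [set C : {set T} | C \subset A & #|C| == k]).
  rewrite inE; case: (boolP (B \subset A)) => //= sBA.
  by rewrite -val_eqE /= inordK // ltnS subset_leq_card.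
by apply: eq_big => // B; rewrite cardBk inE => /andP[_ /eqP->].
Qed.

(** Deleting the block of [x] is a bijection between the two families; its inverse adds the block
    [A :\: C]. *)
Lemma card_partition_complement_block (T : finType) (A C : {set T}) x :
    x \in A -> C \subset A :\ x ->
  #|[set P : {set {set T}} | partition P A & A :\: pblock P x == C]| =
  #|[set Q : {set {set T}} | partition Q C]|.
Proof.
move=> Ax; rewrite subsetD1 => /andP[sCA xNC].
have xB : x \in A :\: C by rewrite inE xNC.
have BNQ Q : partition Q C -> A :\: C \notin Q.
  move=> partQ; apply/negP=> /(partitionS partQ)/subsetP/(_ _ xB).
  exact/negP.
rewrite -[RHS](card_in_imset (f := fun Q => (A :\: C) |: Q)); last first.
  move=> Q1 Q2; rewrite !inE => /BNQ Q1B /BNQ Q2B eqQ.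
  by rewrite -(setU1K Q1B) -(setU1K Q2B) eqQ.
apply: eq_card => P; rewrite inE; apply/andP/imsetP => [[partP /eqP defC] | [Q]].
  have covx : x \in cover P by rewrite (cover_partition partP).
  have PB := pblock_mem covx.
  have defB : A :\: C = pblock P x.
    by rewrite -defC setDDr setDv set0U (setIidPr _) // (partitionS partP).
  exists (P :\ pblock P x); last by rewrite defB setD1K.
  by rewrite inE -defC partitionD1.
rewrite inE => partQ ->.
have partP : partition ((A :\: C) |: Q) A.
  have defA : (A :\: C) :|: C = A by rewrite -{2}(setIidPr sCA) setUC setID.
  rewrite -{2}defA; apply: partitionU1 => //.
    by apply/set0Pn; exists x.
  by rewrite -setI_eq0 setIDAC setDIl setDv setI0.
split=> //; rewrite (def_pblock (partition_trivIset partP) (setU11 _ _) xB).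
by rewrite setDDr setDv set0U (setIidPr sCA).
Qed.

(** Partitions of [A] are sorted by the complement [C] of the block containing [x]. *)
Lemma card_partition_rec (T : finType) (A : {set T}) x : x \in A ->
  #|[set P : {set {set T}} | partition P A]| =
  (\sum_(C : {set T} | C \subset A :\ x)
     #|[set Q : {set {set T}} | partition Q C]|)%N.
Proof.
move=> Ax; rewrite -sum1_card.
rewrite (partition_big (fun P : {set {set T}} => A :\: pblock P x)
           (fun C => C \subset A :\ x)) /=; last first.
  move=> P; rewrite inE => partP; rewrite subsetD1 subsetDl inE mem_pblock.
  by rewrite (cover_partition partP) Ax.
apply: eq_bigr => C sCA; rewrite -(card_partition_complement_block Ax sCA).
by rewrite -sum1_card; apply: eq_bigl => P; rewrite !inE.
Qed.

Lemma card_partition_bell (T : finType) (A : {set T}) :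
  #|[set P : {set {set T}} | partition P A]| = bell #|A|.
Proof.
have [n] := ubnP #|A|; elim: n T A => // n IHn T A leAn.
have [/eqP | /card_gt0P[x Ax]] := posnP #|A|.
  rewrite cards_eq0 => /eqP->.
  have part1 (U : finType) : #|[set P : {set {set U}} | partition P set0]| = 1%N.
    by rewrite -(cards1 (@set0 {set U})); apply: eq_card => P; rewrite !inE partition_set0.
  rewrite cards0 part1 /bell; have -> : [set: 'I_0] = set0 by apply/setP=> -[].
  by rewrite part1.
(* The right-hand side depends only on [#|A|], so this applies both to [A] and to the full ordinal
   set that defines [bell]. No partition has to be transported along a bijection. *)
have rec (U : finType) (B : {set U}) y : y \in B -> #|B| = #|A| ->
    #|[set P : {set {set U}} | partition P B]|%:R =
    \sum_(k < #|A|) (bell k)%:R *+ 'C(#|A|.-1, k) :> int.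
  move=> By eqBA; have cardB' : #|B :\ y|.+1 = #|A| by rewrite -eqBA (cardsD1 y B) By.
  rewrite (card_partition_rec By) natr_sum -cardB' /=.
  rewrite -(sum_subset_card _ (fun k => (bell k)%:R : int)).
  apply: eq_bigr => C sCB; rewrite IHn //.
  by apply: leq_ltn_trans (subset_leq_card sCB) _; rewrite cardB'.
apply/eqP; rewrite -(Num.Theory.eqr_nat int) (rec _ _ x) // /bell.
have A_gt0 : (0 < #|A|)%N by apply/card_gt0P; exists x.
by rewrite (rec _ _ (Ordinal A_gt0)) ?cardsT ?card_ord.
Qed.

Lemma bell0 : bell 0 = 1%N.
Proof.
rewrite /bell -(cards1 (@set0 {set 'I_0})); apply: eq_card => P.
by rewrite !inE -(partition_set0 P); congr partition; apply/setP=> -[].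
Qed.

Lemma bellS n : bell n.+1 = (\sum_(k < n.+1) 'C(n, k) * bell k)%N.
Proof.
apply/eqP; rewrite -(Num.Theory.eqr_nat int) /bell (card_partition_rec (in_setT ord0)).
have cardT' : #|[set: 'I_n.+1] :\ ord0| = n.
  by have := cardsD1 ord0 [set: 'I_n.+1]; rewrite cardsT card_ord inE => -[].
rewrite !natr_sum -/(bell _) (eq_bigr (fun C : {set _} => (bell #|C|)%:R)); last first.
  by move=> C _; rewrite card_partition_bell.
rewrite (sum_subset_card _ (fun k => (bell k)%:R : int)) cardT'.
by apply/eqP/eq_bigr => k _; rewrite natrM mulr_natl.
Qed.

(** * Derangement numbers *)

Lemma sum_support_perm (T : finType) (A : {set T}) :
  (\sum_(B : {set T} | B \subset A) #|[set s : {perm T} | [set x | s x != x] == B]|)%N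
  = #|A|`!.
Proof.
rewrite -card_perm -sum1_card.
rewrite [RHS](partition_big (fun s : {perm T} => [set x | s x != x])
           (fun B => B \subset A)) /=.
  apply: eq_bigr => B sBA; rewrite -sum1_card; apply: eq_bigl => s; rewrite inE.
  rewrite andb_idl // => /eqP defB; rewrite -defB in sBA.
  by apply/subsetP=> x sx; apply: (subsetP sBA); rewrite inE.
move=> s sA; apply/subsetP=> x; rewrite inE => sx; exact: (subsetP sA).
Qed.

(** The recurrence [D_n = n D_(n-1) + (-1)^n], in [int] because of the sign; [derangementE]
    identifies it with the count. *)
Fixpoint derange_seq (n : nat) : int :=
  if n is n'.+1 then n%:R * derange_seq n' + (-1) ^+ n else 1.

(** By induction: since [(k+1) C(n+1,k+1) = (n+1) C(n,k)], the recurrence splits the sum into [n+1]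
    times the previous one and an alternating binomial sum, which vanishes. *)
Lemma sum_binomial_derange_seq n :
  \sum_(k < n.+1) derange_seq k *+ 'C(n, k) = (n`!)%:R.
Proof.
elim: n => [|n IHn]; first by rewrite big_ord_recl big_ord0.
have alt0 : \sum_(k < n.+2) (-1) ^+ k *+ 'C(n.+1, k) = 0 :> int.
  have := exprBn (1 : int) 1 n.+1; rewrite subrr expr0n /= => /esym; apply: etrans.
  by apply: eq_bigr => i _; rewrite !expr1n !mulr1.
rewrite factS natrM -IHn -[RHS]addr0 -[X in _ = _ + X]alt0.
rewrite big_ord_recl [X in _ = _ + X]big_ord_recl /=.
rewrite addrCA; congr (_ + _); rewrite mulr_sumr -big_split /=.
apply: eq_bigr => k _; rewrite /bump /= add0n add1n mulrnDl; congr (_ + _).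
rewrite -mulrnAl mulrnAr -mulrnAl -!mulrnA -mul_bin_diag.
by rewrite mulnC.
Qed.

(* Both sides solve \sum_(B \subset A) x B = #|A|`! , which determines x. *)
Lemma card_perm_support (T : finType) (A : {set T}) :
  #|[set s : {perm T} | [set x | s x != x] == A]|%:R = derange_seq #|A|.
Proof.
have [n] := ubnP #|A|; elim: n A => // n IHn A leAn.
have := sum_binomial_derange_seq #|A|.
rewrite -sum_subset_card -sum_support_perm natr_sum.
rewrite [LHS](bigD1 A) // [RHS](bigD1 A) //=.
rewrite [X in _ = _ + X](eq_bigr (fun B : {set T} => derange_seq #|B|)).
  by move/addIr.
move=> B /andP[sBA neqBA]; apply: IHn; apply: leq_trans (_ : #|A| <= n)%N => //.
by apply: proper_card; rewrite properEneq neqBA.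
Qed.

Lemma derangementE n : (derangement n)%:R = derange_seq n.
Proof.
(* Derangements are the permutations whose support is the whole set. *)
rewrite -[n in RHS]card_ord -cardsT -card_perm_support; congr _%:R.
apply: eq_card => s; rewrite !inE; apply/forallP/eqP => [sP | sT i].
  by apply/setP=> i; rewrite !inE sP.
by have := in_setT i; rewrite -sT inE.
Qed.

(** * Fermat's little theorem and the Bell functional *)

Lemma Fp_expXp p (a : 'F_p) : prime p -> a ^+ p = a.
Proof. by move=> p_prime; have := expf_card a; rewrite card_Fp. Qed.

Lemma Fp_expXp1 p (a : 'F_p) : prime p -> a != 0 -> a ^+ p.-1 = 1.
Proof.
move=> p_prime a_neq0; apply: (mulfI a_neq0).
by rewrite -exprS prednK ?prime_gt0 // mulr1 Fp_expXp.
Qed.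

(** The functional [L] of the overview, over any coefficient ring. *)
Definition bell_umbra (R : nzRingType) (f : {poly R}) : R :=
  \sum_(i < size f) f`_i * (bell i)%:R.

Lemma bell_umbra_widen (R : nzRingType) (f : {poly R}) n : (size f <= n)%N ->
  bell_umbra f = \sum_(i < n) f`_i * (bell i)%:R.
Proof.
move=> le_fn; rewrite /bell_umbra (big_ord_widen n (fun i => f`_i * (bell i)%:R)) //.
rewrite big_mkcond; apply: eq_bigr => i _.
by case: ltnP => // le_fi; rewrite nth_default ?mul0r.
Qed.

Lemma bell_umbra_is_linear (R : nzRingType) : scalar (@bell_umbra R).
Proof.
move=> a f g; pose n := maxn (size (a *: f + g)) (maxn (size f) (size g)).
rewrite !(@bell_umbra_widen _ _ n) ?leq_max ?leqnn ?orbT //.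
rewrite mulr_sumr -big_split; apply: eq_bigr => i _ /=.
by rewrite coefD coefZ mulrDl mulrA.
Qed.

HB.instance Definition _ (R : nzRingType) :=
  GRing.isLinear.Build R {poly R} R *%R (@bell_umbra R) (@bell_umbra_is_linear R).

Lemma bell_umbraXn (R : nzRingType) n : bell_umbra ('X^n : {poly R}) = (bell n)%:R.
Proof.
rewrite (@bell_umbra_widen _ _ n.+1) ?size_polyXn // big_ord_recr /= coefXn eqxx mul1r.
rewrite big1 ?add0r // => i _; rewrite coefXn.
by rewrite eq_sym gtn_eqF ?mul0r.
Qed.

Lemma bell_umbraC (R : nzRingType) (c : R) : bell_umbra c%:P = c.
Proof.
by rewrite -[c%:P]mulr1 mul_polyC linearZ /= -(expr0 'X) bell_umbraXn bell0 mulr1.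
Qed.

(** By linearity it suffices to take [f = X^i], where the binomial expansion of [(X+1)^i] turns the
    claim into the Bell recurrence. *)
Lemma bell_umbra_mulX (R : comNzRingType) (f : {poly R}) :
  bell_umbra ('X * f) = bell_umbra (f \Po ('X + 1)).
Proof.
rewrite comp_polyE -{1}[f]coefK poly_def mulr_sumr !linear_sum.
apply: eq_bigr => i _; rewrite -scalerAr !linearZ /= -exprS bell_umbraXn bellS.
congr (_ * _); rewrite addrC exprDn linear_sum natr_sum; apply: eq_bigr => k _.
by rewrite expr1n mul1r linearMn /= bell_umbraXn natrM mulr_natl.
Qed.

(** Split off the factor [X]; shifting the remaining factors by one yields the falling factorial of
    length one less. *)
Lemma bell_umbra_falling (R : comNzRingType) n :
  bell_umbra (\prod_(i < n) ('X - i%:R%:P) : {poly R}) = 1.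
Proof.
elim: n => [|n IHn]; first by rewrite big_ord0 -polyC1 bell_umbraC.
rewrite big_ord_recl subr0 bell_umbra_mulX -[RHS]IHn rmorph_prod.
congr bell_umbra; apply: eq_bigr => i _ /=.
rewrite comp_polyB comp_polyX comp_polyC /bump /= add1n -addn1 natrD polyCD polyC1.
by rewrite [_ + 1 in X in _ - X]addrC opprD addrA addrK.
Qed.

(* The product of all X - x, x in F_p, is both
   X^p - X and the falling factorial X(X-1)...(X-p+1). *)
Lemma bell_umbraXp p : prime p -> bell_umbra ('X^p : {poly 'F_p}) = 2.
Proof.
move=> p_prime; have := finField_genPoly 'F_p; rewrite card_Fp // => /eqP.
rewrite subr_eq => /eqP->; rewrite linearD /= -{2}(expr1 'X) bell_umbraXn.
have -> : \prod_(x : 'F_p) ('X - x%:P) = \prod_(i < p) ('X - i%:R%:P) :> {poly 'F_p}.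
  rewrite -(big_mkord xpredT (fun i => 'X - (i%:R : 'F_p)%:P)).
  rewrite -[X in index_iota 0 X](Fp_cast p_prime).
  by rewrite big_mkord; apply: eq_bigr => x _; rewrite natr_Zp.
by rewrite bell_umbra_falling bellS big_ord_recl big_ord0 bell0.
Qed.

(** * The recursion in [m] over ['F_p] *)

Lemma bell_umbra_recursion p m : prime p ->
  bell_umbra (('X + m.+1%:R%:P) ^+ p.-1 : {poly 'F_p}) =
  2 + m%:R - m%:R * bell_umbra (('X + m%:R%:P) ^+ p.-1 : {poly 'F_p}).
Proof.
move=> p_prime; have p_char := pchar_Fp p_prime.
set g := ('X + m%:R%:P) ^+ p.-1.
(* Frobenius gives [(X+m)^p = X^p + m^p], and [m^p = m] in ['F_p]. *)
have <- : bell_umbra (('X + m%:R%:P) ^+ p : {poly 'F_p}) = 2 + m%:R.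
  rewrite -(pFrobenius_autE (_ : p \in [pchar {poly 'F_p}])) ?pchar_poly // => p_charX.
  rewrite pFrobenius_autD_comm; last exact: mulrC.
  rewrite !pFrobenius_autE linearD /= bell_umbraXp //; congr (_ + _).
  by rewrite -rmorphXn /= bell_umbraC Fp_expXp.
have -> : ('X + m%:R%:P) ^+ p = 'X * g + m%:R *: g.
  by rewrite -mul_polyC -mulrDl -exprS prednK ?prime_gt0.
rewrite linearD linearZ /= addrK bell_umbra_mulX rmorphXn /=.
congr (bell_umbra (_ ^+ _)).
by rewrite comp_polyD comp_polyX comp_polyC -[m.+1]addn1 natrD polyCD polyC1 -addrA [1 + _]addrC.
Qed.

Lemma bell_umbra_derange_seq p m : prime p ->
  bell_umbra (('X + m.+1%:R%:P) ^+ p.-1 : {poly 'F_p}) =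
  1 + (-1) ^+ m * (derange_seq m)%:~R.
Proof.
move=> p_prime; elim: m => [|m IHm].
  (* At [m = 0] the factor [m] kills the last term, so the value of [L] at [X^(p-1)] is never
     computed. *)
  by rewrite bell_umbra_recursion // mul0r subr0 addr0 mul1r.
rewrite bell_umbra_recursion // IHm /= rmorphD rmorphM rmorphXn /= rmorphN1 rmorph_nat.
have sgnK : (-1) ^+ m * (-1) ^+ m = 1 :> 'F_p by rewrite -exprMn mulrNN mulr1 expr1n.
rewrite !exprS; ring: sgnK.
Qed.

(** In characteristic [p], [(X-a)^p = X^p - a^p]; cancelling [X - a] shows that [(X-a)^(p-1)] is the
    geometric sum of the [X^k a^(p-1-k)]. *)
Lemma sum_bell_Fp p (a : 'F_p) : prime p -> a != 0 ->
  \sum_(1 <= k < p) (bell k)%:R * a ^+ (p.-1 - k) =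
  bell_umbra (('X - a%:P) ^+ p.-1) - 1.
Proof.
move=> p_prime a_neq0; have p_gt0 := prime_gt0 p_prime.
have p_char := pchar_Fp p_prime.
have XaE : ('X - a%:P) ^+ p.-1 = \sum_(k < p) 'X^k * a%:P ^+ (p.-1 - k) :> {poly 'F_p}.
  have Xa_neq0 : 'X - a%:P != 0 by rewrite polyXsubC_eq0.
  apply: (mulfI Xa_neq0); rewrite -exprS prednK //.
  have p_charX : p \in [pchar {poly 'F_p}] by rewrite pchar_poly.
  rewrite -(pFrobenius_autE p_charX) pFrobenius_autB_comm ?pFrobenius_autE; last exact: mulrC.
  rewrite subrXX; congr (_ * _); rewrite (reindex_inj rev_ord_inj) /=.
  apply: eq_bigr => k _; have ltkp := ltn_ord k.
  by congr ('X^_ * _ ^+ _); rewrite /=; lia.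
rewrite XaE linear_sum -(big_mkord xpredT (fun k => bell_umbra ('X^k * a%:P ^+ (p.-1 - k)))).
have umbraE k : bell_umbra ('X^k * a%:P ^+ (p.-1 - k)) = (bell k)%:R * a ^+ (p.-1 - k).
  by rewrite -rmorphXn mulrC mul_polyC linearZ /= bell_umbraXn mulrC.
(* The term [k = 0] is [a^(p-1) = 1], which accounts for the [- 1]. *)
rewrite big_ltn // umbraE bell0 mul1r subn0.
by rewrite Fp_expXp1 // addrAC subrr add0r; apply: eq_bigr => k _; rewrite umbraE.
Qed.

(** * From ['F_p] back to the rationals *)

(** The fraction need not be reduced: cross-multiplying, a factor [p] of [denq x] would also divide
    [numq x], against coprimality. *)
Lemma p_integral_div p (a b : int) : prime p -> ~~ (p%:Z %| b)%Z ->
  p_integral p (a%:~R / b%:~R).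
Proof.
move=> p_prime p_ndvd_b; rewrite /p_integral; set x := _ / _.
have b_neq0 : b != 0 by apply: contraNneq p_ndvd_b => ->; rewrite dvdz0.
apply/negP=> p_den.
have eqx : numq x * b = a * denq x.
  apply: (@intr_inj rat); rewrite !rmorphM /= numqE.
  by rewrite mulrAC divfK // intr_eq0.
have: (p%:Z %| numq x * b)%Z by rewrite eqx dvdz_mull.
rewrite dvdzE abszM Euclid_dvdM //= -[(p %| `|b|)%N]/(p%:Z %| b)%Z (negPf p_ndvd_b) orbF.
move=> p_num; have := coprime_num_den x.
rewrite /coprime => /eqP cop; have : (p %| gcdn `|numq x| `|denq x|)%N.
  by rewrite dvdn_gcd p_num.
by rewrite cop dvdn1 => /eqP p1; rewrite p1 in p_prime.
Qed.

Theorem theorem1 (m p : nat) (m_gt0 : (0 < m)%N) (p_prime : prime p)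
    (p_ndvd_m : ~~ (p %| m)%N) :
  rat_congr p
    (\sum_(1 <= k < p) (bell k)%:R / (- m%:R) ^+ k)
    ((-1) ^+ (m - 1) * (derangement (m - 1))%:R).
Proof.
have p_char := pchar_Fp p_prime.
have dvdp (n : int) : (p%:Z %| n)%Z = (n%:~R == 0 :> 'F_p) := dvdz_pcharf p_char n.
have m_neq0 : - m%:R != 0 :> rat by rewrite oppr_eq0 Num.Theory.pnatr_eq0 -lt0n.
have mFp_neq0 : - m%:R != 0 :> 'F_p by rewrite oppr_eq0 -(dvdn_pcharf p_char).
(* Over the common denominator [b] the sum is [N / b], so the congruence reduces to [p] dividing
   [N - d * b], tested in ['F_p], where [b = 1]. *)
pose N : int := \sum_(1 <= k < p) (bell k)%:R * (- m%:R) ^+ (p.-1 - k).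
pose b : int := (- m%:R) ^+ p.-1.
pose d : int := (-1) ^+ (m - 1) * (derangement (m - 1))%:R.
have p_ndvd_b : ~~ (p%:Z %| b)%Z.
  by rewrite dvdp rmorphXn rmorphN rmorph_nat /= expf_neq0.
have p_ndvd_1 : ~~ (p%:Z %| 1)%Z by rewrite dvdp oner_eq0.
have sumE : \sum_(1 <= k < p) (bell k)%:R / (- m%:R) ^+ k = N%:~R / b%:~R :> rat.
  rewrite /N rmorph_sum mulr_suml; apply: eq_big_nat => k /andP[_ ltkp].
  rewrite rmorphM !rmorphXn rmorphN !rmorph_nat /=.
  have lekp : (k <= p.-1)%N by rewrite -ltnS (ltn_predK ltkp).
  rewrite -[in X in _ = _ / X](subnK lekp) exprD.
  by field; rewrite !expf_neq0.
have dE : (-1) ^+ (m - 1) * (derangement (m - 1))%:R = d%:~R :> rat.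
  by rewrite rmorphM rmorphXn rmorphN1 rmorph_nat.
have : (p%:Z %| N - d * b)%Z.
  rewrite dvdp rmorphB rmorphM /= subr_eq0; apply/eqP.
  have -> : b%:~R = 1 :> 'F_p.
    by rewrite rmorphXn rmorphN rmorph_nat /= Fp_expXp1.
  rewrite mulr1 /N rmorph_sum /=.
  rewrite (eq_bigr (fun k => (bell k)%:R * (- m%:R) ^+ (p.-1 - k))); last first.
    by move=> k _; rewrite rmorphM rmorphXn rmorphN !rmorph_nat.
  (* With [a = -m] the base [X - a] is [X + m]; [m] is then written as a successor to match the
     closed form at index [m - 1]. *)
  rewrite sum_bell_Fp // polyCN opprK -[m in m%:R](@ltn_predK 0) //.
  rewrite bell_umbra_derange_seq // addrAC subrr add0r.
  by rewrite rmorphM rmorphXn rmorphN1 subn1 derangementE.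
case/dvdzP=> q eqq; rewrite sumE dE; split.
- exact: p_integral_div.
- by rewrite -[d%:~R]divr1 -[1]/(1%:~R); apply: p_integral_div.
(* From [N - d b = q p] one gets [N / b - d = p (q / b)]. *)
exists (q%:~R / b%:~R); first exact: p_integral_div.
have b_neq0 : b%:~R != 0 :> rat by rewrite rmorphXn rmorphN rmorph_nat /= expf_neq0.
have -> : N = q * p%:Z + d * b by rewrite -eqq subrK.
rewrite rmorphD !rmorphM /=; field.
exact: b_neq0.
Qed.
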